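(* For every $r\in\mathbb{N}$ there exists a set $E\subset\mathbb{N}$ such that for every $\ell\in\{1,\ldots,r\}$ (with all the densities below existing) we have (i) $d(E\cap(E-n_1)\cap\cdots\cap(E-n_\ell))<d(E)^{\ell+1}$ for all distinct $n_1,\ldots,n_\ell\in\mathbb{N}$; (ii) $\lim_{n_1,\ldots,n_\ell}d(E\cap(E-n_1)\cap\cdots\cap(E-n_\ell))=d(E)^{\ell+1}$, where the limit is taken as $\min\{n_1,n_2-n_1,\ldots,n_\ell-n_{\ell-1}\}\to\infty$. Moreover, for every $r\in\mathbb{N}$ there exists $E\subset\mathbb{N}$ such that for every $\ell\in\{1,\ldots,r\}$ property (i) holds with the strict inequality reversed (that is, $d(E\cap(E-n_1)\cap\cdots\cap(E-n_\ell))>d(E)^{\ell+1}$ for all distinct $n_1,\ldots,n_\ell\in\mathbb{N}$) and property (ii) holds.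
   Context: $\mathbb{N}=\{1,2,\ldots\}$. For $E\subset\mathbb{N}$, $d(E)=\lim_{N\to\infty}\frac{1}{N}|E\cap\{1,\ldots,N\}|$ is the (natural) density of $E$, and writing $d(E)$ implicitly asserts that the limit exists. $E-n=\{m-n\colon m\in E\}$. *)

(* Defs.v *)
From HB Require Import structures.
From mathcomp Require Import all_boot all_order all_algebra.
From mathcomp Require Import all_classical all_reals all_analysis.

Set Implicit Arguments.
Unset Strict Implicit.
Unset Printing Implicit Defensive.

Import Order.TTheory GRing.Theory Num.Theory.
Import numFieldNormedType.Exports.

Local Open Scope classical_set_scope.
Local Open Scope ring_scope.

(* |A `&` {1, ..., N}| / N; the junk value at N = 0 does not affect limits. *)
Definition density_ratio (R : realType) (A : set nat) (N : nat) : R :=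
  (count (mem A) (index_iota 1 N.+1))%:R / N%:R.

Definition has_density (R : realType) (A : set nat) : Prop :=
  cvgn (density_ratio R A).

(* Meaningful only under [has_density R A]. *)
Definition density (R : realType) (A : set nat) : R :=
  limn (density_ratio R A).

(* The nonnegative part of E - n = {m - n : m \in E}. It is written as a
   preimage because truncated subtraction would send every m <= n to 0. *)
Definition shift (E : set nat) (n : nat) : set nat := [set k | E (k + n)%N].

(* E `&` (E - n_1) `&` ... `&` (E - n_l) *)
Definition multi_return (E : set nat) (l : nat) (n : l.-tuple nat) : set nat :=
  E `&` \bigcap_(m in [set` n]) shift E m.

(* min {n_1, n_2 - n_1, ..., n_l - n_(l-1)} >= M, the path starting at 0;
   the differences are signed, hence the additive form. *)
Definition gaps_ge (M l : nat) (n : l.-tuple nat) : bool :=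
  path (fun a b => (a + M <= b)%N) 0%N n.

(* The filter "min {n_1, n_2 - n_1, ..., n_l - n_(l-1)} --> oo" *)
Definition gaps_to_infty (l : nat) : set_system (l.-tuple nat) :=
  filter_from [set: nat] (fun M => [set n | gaps_ge M n]).
Arguments gaps_to_infty l : clear implicits.

Lemma gaps_ge_le (M M' l : nat) (n : l.-tuple nat) :
  (M <= M')%N -> gaps_ge M' n -> gaps_ge M n.
Proof.
move=> leM; rewrite /gaps_ge; apply: sub_path => a b.
by apply: leq_trans; rewrite leq_add2l.
Qed.

Lemma gaps_ge_ex (M l : nat) : exists n : l.-tuple nat, gaps_ge M n.
Proof.
suff H k a : exists2 s : seq nat, size s = k & path (fun a b => (a + M <= b)%N) a s.
  by have [s /eqP sz ps] := H l 0%N; exists (Tuple sz).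
elim: k a => [|k IHk] a; first by exists [::].
by have [s sz ps] := IHk (a + M)%N; exists ((a + M)%N :: s); rewrite /= ?sz ?leqnn.
Qed.

#[global] Instance gaps_to_infty_filter (l : nat) :
  ProperFilter (gaps_to_infty l).
Proof.
apply: filter_from_proper => [|M _]; last exact: gaps_ge_ex.
apply: filter_from_filter; first by exists 0%N.
move=> M M' _ _; exists (maxn M M') => // n /= nM; split.
  exact: gaps_ge_le (leq_maxl _ _) nM.
exact: gaps_ge_le (leq_maxr _ _) nM.
Qed.

(* Main.v *)
(* Join each pair of integers {i, i + m + 1} by an edge and let the edges act
   independently, an edge of length m + 1 with kill probability
   beta_m = 1 / (m + 2)^2.  For an under-recurrent set it kills i with
   probability beta_m, kills i + m + 1 with probability beta_m, and never both;
   for an over-recurrent set it kills both endpoints together with probability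
   beta_m.  Let E be the set of integers that no edge kills.  Only the edges
   inside S correlate the survival of its points, so S survives with
   probability exactly c^|S| times the product, over the pairs x < y in S, of
   (1 - 2 beta) / (1 - beta)^2 < 1, respectively 1 / (1 - beta) > 1, where
   beta = beta_(y-x-1) and c = prod_m (1 - beta_m)^2 = 1/4.  These factors tend
   to 1 as y - x grows.

   The random set is derandomized by exhausting a finite sample space: with
   edge lengths at most t and words of length t + 1, concatenate the words
   given by all outcomes and repeat periodically.  The set E follows the t-th
   periodic set on the t-th of a sequence of fast growing intervals. *)
Require Import Defs.
From mathcomp Require Import all_boot all_order all_algebra.
From mathcomp Require Import all_classical all_reals all_analysis.
From mathcomp Require Import zify ring lra.

Set Implicit Arguments.
Unset Strict Implicit.
Unset Printing Implicit Defensive.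

Import Order.TTheory GRing.Theory Num.Theory.
Import numFieldNormedType.Exports.

Local Open Scope classical_set_scope.
Local Open Scope ring_scope.

(** * Correlation counts along periodic concatenations of words *)

Definition translates_in (X : pred nat) (S : seq nat) (k : nat) : bool :=
  all (fun s => X (k + s)%N) S.

Lemma norm_sum_nat_le (R : realFieldType) (f : nat -> R) (C : R) (u v : nat) :
  (u <= v)%N -> (forall k, (u <= k < v)%N -> `|f k| <= C) ->
  `|\sum_(u <= k < v) f k| <= C * (v - u)%:R.
Proof.
move=> uv fC; apply: le_trans (ler_norm_sum _ _ _) _.
apply: le_trans (ler_sum_nat _) _; first exact: fC.
by rewrite sumr_const_nat mulr_natr.
Qed.

Lemma sum_nat_blocks (R : realFieldType) (f : nat -> R) (n L : nat) :
  \sum_(0 <= k < n * L) f k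
    = \sum_(0 <= i < n) \sum_(0 <= j < L) f (i * L + j)%N.
Proof.
rewrite big_nat_mul; apply: eq_bigr => i _.
rewrite -{1}[(i * L)%N]add0n big_addn mulSn addnK.
by apply: eq_bigr => j _; rewrite addnC.
Qed.

Lemma sum_periodic_bound (R : realFieldType) (f : nat -> R) (P : nat) (G : R) :
  (0 < P)%N -> (forall k, f (k + P)%N = f k) -> (forall k, `|f k| <= 1) ->
  `|\sum_(0 <= k < P) f k| <= G * P%:R ->
  forall N, `|\sum_(0 <= k < N) f k| <= G * N%:R + P%:R.
Proof.
move=> P0 fP f1 GP N.
have G0 : 0 <= G by rewrite -(@pmulr_lge0 _ P%:R) ?ltr0n//; apply: le_trans GP.
have fM q j : f (q * P + j)%N = f j.
  by elim: q => [//|q IH]; rewrite mulSn -addnA (addnC P) fP.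
rewrite {1}(divn_eq N P) (@big_cat_nat _ _ _ (N %/ P * P)) ?leq_addr//=.
apply: le_trans (ler_normD _ _) _; apply: lerD.
  rewrite sum_nat_blocks; apply: le_trans (ler_norm_sum _ _ _) _.
  apply: (@le_trans _ _ (\sum_(0 <= i < N %/ P) G * P%:R)).
    by apply: ler_sum => i _; under eq_bigr do rewrite fM.
  rewrite sumr_const_nat subn0 -mulrnAr -mulrnA; apply: ler_wpM2l => //.
  by rewrite ler_nat mulnC leq_divM.
apply: le_trans (@norm_sum_nat_le _ _ 1 _ _ _ _) _; [exact: leq_addr|by []|].
by rewrite mul1r addKn ler_nat ltnW ?ltn_pmod.
Qed.

(** Each block of length [L] holds one outcome, in the order of [enum W], so averaging over a period
    is averaging over the uniform law on [W]. *)
Definition cyclic_words (W : finType) (x : W -> pred nat) (L : nat) : pred nat :=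
  fun k => nth false [seq x w (k %% L)%N | w <- enum W] (k %/ L %% #|W|)%N.

(** At an offset [j] with [j + K < L] the translate of [S] stays inside one block, and letting the
    block run over a period counts outcomes exactly, so these terms cancel. What remains is at most
    the last [K] offsets of each block. *)
Lemma cyclic_words_discrepancy (R : realFieldType) (W : finType)
    (x : W -> pred nat) (L K : nat) (S : seq nat) (D : R) :
  (0 < #|W|)%N -> (0 < L)%N -> (forall s, s \in S -> (s <= K)%N) ->
  0 <= D <= 1 ->
  (forall j, (j + K < L)%N ->
     #|[pred w | translates_in (x w) S j]|%:R = D * #|W|%:R) ->
  forall N,
    `|\sum_(0 <= k < N) ((translates_in (cyclic_words x L) S k)%:R - D)|
      <= K%:R / L%:R * N%:R + (#|W| * L)%:R.
Proof.
move=> W0 L0 SK D01 HD.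
have [w0 _] := card_gt0P W0.
set f := fun k : nat => (translates_in (cyclic_words x L) S k)%:R - D.
have f1 k : `|f k| <= 1.
  by rewrite /f; case: (translates_in _ _ _); rewrite ler_norml/=; lra.
apply: (@sum_periodic_bound _ f) => //; first by rewrite muln_gt0 W0.
  move=> k; rewrite /f /translates_in; congr (_%:R - _); congr nat_of_bool.
  apply: eq_all => s; rewrite /cyclic_words addnAC addnC modnMDl divnMDl//.
  by rewrite modnDl.
rewrite sum_nat_blocks exchange_big_nat/=.
have inblock i j s : (i < #|W|)%N -> (j + s < L)%N ->
    cyclic_words x L (i * L + j + s)%N = x (nth w0 (enum W) i) (j + s)%N.
  move=> iW jsL; rewrite /cyclic_words -addnA modnMDl divnMDl//.
  rewrite divn_small// addn0 !modn_small//.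
  by rewrite (nth_map w0) -?cardE.
have good j : (j + K < L)%N -> \sum_(0 <= i < #|W|) f (i * L + j)%N = 0.
  move=> jK; rewrite sumrB sumr_const_nat subn0 -mulr_natr -(HD j jK).
  apply/eqP; rewrite subr_eq0 -natr_sum eqr_nat; apply/eqP.
  transitivity (\sum_(0 <= i < size (enum W))
                  (translates_in (x (nth w0 (enum W) i)) S j : nat))%N.
    rewrite -cardE; apply: eq_big_nat => i /andP[_ iW]; congr nat_of_bool.
    by apply: eq_in_all => s sS; apply: inblock => //; have := SK s sS; lia.
  rewrite -(big_nth w0 xpredT (fun w => nat_of_bool (translates_in (x w) S j))).
  rewrite big_enum /= -sum1_card [RHS]big_mkcond.
  by apply: eq_bigr => w _; rewrite inE; case: translates_in.
(* If [L < K], the truncated [L - K] is 0 and every offset counts as bad; there are still at most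
   [K] of them. *)
rewrite (@big_cat_nat _ _ _ (L - K))//= ?leq_subr//.
rewrite big_nat big1 ?add0r; last by move=> j jLK; apply: good; lia.
apply: le_trans (@norm_sum_nat_le _ _ #|W|%:R _ _ (leq_subr _ _) _) _.
  move=> j _; apply: le_trans (@norm_sum_nat_le _ _ 1 _ _ (leq0n _) _) _ => //.
  by rewrite subn0 mul1r.
have -> : K%:R / L%:R * (#|W| * L)%:R = #|W|%:R * K%:R :> R.
  by rewrite natrM; field; rewrite pnatr_eq0 -lt0n.
rewrite ler_wpM2l// ler_nat; lia.
Qed.

(** * Products over the edges that meet a finite set of vertices *)

Lemma prod_ord_if_eq (R : comNzRingType) (n z : nat) (c : nat -> R) :
  \prod_(i < n) (if z == i then c i else 1) = if (z < n)%N then c z else 1.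
Proof.
rewrite -big_mkcond/=; case: ltnP => zn.
  by rewrite (big_pred1 (Ordinal zn)).
by rewrite big_pred0// => i; apply/eqP => zi; have := ltn_ord i; lia.
Qed.

Lemma if_mem_prod (R : comNzRingType) (V : seq nat) (z : nat) (r : R) :
  uniq V -> (if z \in V then r else 1) = \prod_(y <- V) if y == z then r else 1.
Proof.
move=> uV; case: ifPn => zV.
  rewrite (bigD1_seq z)//= eqxx big1 ?mulr1// => y yz.
  by rewrite (negbTE yz).
rewrite big1_seq// => y /andP[_ yV]; case: eqP => // yz.
by rewrite -yz yV in zV.
Qed.

Lemma prod_ord_if_mem (R : comNzRingType) (n : nat) (V : seq nat)
    (c : nat -> R) :
  uniq V -> (forall v, v \in V -> (v < n)%N) ->
  \prod_(i < n) (if (i : nat) \in V then c i else 1) = \prod_(v <- V) c v.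
Proof.
move=> uV Vn; rewrite (eq_bigr _ (fun (i : 'I_n) _ => if_mem_prod i (c i) uV)).
rewrite exchange_big/=; apply: eq_big_seq => v vV.
by rewrite prod_ord_if_eq Vn.
Qed.

Lemma card_ord_outside (Q lo len : nat) : (lo + len <= Q)%N ->
  #|[pred q : 'I_Q | ~~ (lo <= q < lo + len)%N]| = (Q - len)%N.
Proof.
move=> loQ; have := cardC [pred q : 'I_Q | (lo <= q < lo + len)%N].
suff -> : #|[pred q : 'I_Q | (lo <= q < lo + len)%N]| = len.
  by rewrite card_ord => /esym QE; rewrite [X in (X - _)%N]QE addKn; apply: eq_card.
rewrite -sum1_card.
under eq_bigl do rewrite inE.
rewrite -(big_mkord (fun q => lo <= q < lo + len)%N (fun=> 1%N)).
rewrite -big_nat_widen// -(big_nat_widenl lo 0 _ xpredT)//.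
by rewrite sum_nat_const_nat muln1 addKn.
Qed.

Lemma prodr_const_size (R : comNzRingType) (I : Type) (s : seq I) (c : R) :
  \prod_(i <- s) c = c ^+ size s.
Proof. by rewrite big_const_seq count_predT -Monoid.iteropE. Qed.

Definition kill_prob (R : realFieldType) (m : nat) : R := ((m.+2 ^ 2)%:R)^-1.

(* [b = true] is the exclusive rule (under-recurrence), [b = false] the joint one:
   the two points survive their common edge with probability 1 - (1 + b) beta. *)
Definition pair_ratio (R : realFieldType) (b : bool) (m : nat) : R :=
  (1 - b.+1%:R * kill_prob R m) / (1 - kill_prob R m) ^+ 2.

(** The value 1 off [x < y] makes a double product count each unordered pair once; an edge of length
    [d] has index [d - 1]. *)
Definition pair_factor (R : realFieldType) (b : bool) (x y : nat) : R :=
  if (x < y)%N then pair_ratio R b (y - x).-1 else 1.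

Lemma kill_prob_bounds (R : realFieldType) (m : nat) :
  0 < kill_prob R m <= 4%:R^-1.
Proof.
rewrite invr_gt0 ltr0n expn_gt0/= lef_pV2 ?posrE ?ltr0n ?expn_gt0//.
by rewrite ler_nat expnS; nia.
Qed.

(** Each vertex of [V] is the left end of one edge of every length up to [t] and the right end of
    another; hence the square. An edge with both ends in [V] is determined by them, and the bound on
    the diameter of [V] gives every pair its edge. *)
Lemma prod_edges (R : realFieldType) (b : bool) (t n : nat) (V : seq nat) :
  uniq V -> (forall v, v \in V -> (t <= v < n)%N) ->
  {in V &, forall x y, (y <= x + t)%N} ->
  \prod_(e : 'I_n * 'I_t)
     ((if (e.1 : nat) \in V then 1 - kill_prob R e.2 else 1) *
      (if (e.1 + e.2.+1)%N \in V then 1 - kill_prob R e.2 else 1) *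
      (if ((e.1 : nat) \in V) && ((e.1 + e.2.+1)%N \in V)
       then pair_ratio R b e.2 else 1))
  = (\prod_(m < t) (1 - kill_prob R m)) ^+ 2 ^+ size V *
    \prod_(x <- V) \prod_(y <- V) pair_factor R b x y.
Proof.
move=> uV Vn Vt; rewrite !big_split /=; congr (_ * _); last first.
  rewrite -(pair_bigA _ (fun (i : 'I_n) (m : 'I_t) =>
    if ((i : nat) \in V) && ((i + m.+1)%N \in V) then pair_ratio R b m
    else 1))/=.
  transitivity (\prod_(i < n) (if (i : nat) \in V then \prod_(m < t)
     (if (i + m.+1)%N \in V then pair_ratio R b m else 1) else 1)).
    by apply: eq_bigr => i _; case: ifP => //= _; rewrite big1.
  rewrite (prod_ord_if_mem (fun i => \prod_(m < t)
     (if (i + m.+1)%N \in V then pair_ratio R b m else 1)))//; last first.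
    by move=> v /Vn /andP[].
  apply: eq_big_seq => x xV.
  rewrite (eq_bigr _ (fun (m : 'I_t) _ =>
    if_mem_prod (x + m.+1)%N (pair_ratio R b m) uV)).
  rewrite exchange_big/=; apply: eq_big_seq => y yV; rewrite /pair_factor.
  case: ltnP => xy; last first.
    by rewrite big1// => i _; case: eqP => //; lia.
  have yt : ((y - x).-1 < t)%N by have := Vt _ _ xV yV; lia.
  transitivity (if ((y - x).-1 < t)%N then pair_ratio R b (y - x).-1 else 1);
    last by rewrite yt.
  rewrite -prod_ord_if_eq; apply: eq_bigr => i _.
  by congr (if _ then _ else _); apply/eqP/eqP; lia.
rewrite -exprM mulnC exprM expr2; congr (_ * _).
  rewrite -(pair_bigA _ (fun (i : 'I_n) (m : 'I_t) =>
    if (i : nat) \in V then 1 - kill_prob R m else 1))/=.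
  rewrite -prodr_const_size.
  rewrite -(@prod_ord_if_mem _ n V (fun=> \prod_(m < t) (1 - kill_prob R m)))//.
    by apply: eq_bigr => i _; case: ifP => // _; rewrite big1.
  by move=> v /Vn /andP[].
rewrite -(pair_bigA _ (fun (i : 'I_n) (m : 'I_t) =>
    if (i + m.+1)%N \in V then 1 - kill_prob R m else 1))/=.
rewrite exchange_big -prodrXl/=; apply: eq_bigr => m _.
(* Right ends are indexed by the left end [v - m.+1]; the subtraction is exact because
   [m < t <= v]. *)
have inV (i : nat) : ((i + m.+1)%N \in V) = (i \in [seq (v - m.+1)%N | v <- V]).
  apply/idP/mapP => [iV|[v vV ->]]; first by exists (i + m.+1)%N; rewrite ?addnK.
  by rewrite subnK//; have := Vn v vV; have := ltn_ord m; lia.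
under eq_bigr do rewrite inV.
rewrite (@prod_ord_if_mem _ _ _ (fun=> 1 - kill_prob R m)).
- by rewrite prodr_const_size size_map.
- rewrite map_inj_in_uniq// => x y xV yV.
  by have := Vn _ xV; have := Vn _ yV; have := ltn_ord m; lia.
- by move=> _ /mapP[v vV ->]; have := Vn _ vV; lia.
Qed.

(** * The finite sample space and the exact survival count *)

(* Divisible by (m + 2)^2 for all m < t, which makes the kill probabilities exact
   for the uniform law. *)
Definition alphabet_size (t : nat) : nat := (t.+1`! ^ 2)%N.

(* The edge (i, m) joins the vertices i and i + m + 1; position j of a word is the
   vertex j + t, so that all the edges reaching it from the left are present. *)
Definition edge_states (t L : nat) : finType :=
  {ffun 'I_(L + t) * 'I_t -> 'I_(alphabet_size t)}.

Definition kills_left (t m q : nat) : bool := (q < alphabet_size t %/ m.+2 ^ 2)%N.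

(** The interval [[a, 2a)] for [b = true] is disjoint from the left-killing interval [[0, a)]; for
    [b = false] the two coincide. The marginals agree and only the coupling differs. *)
Definition kills_right (b : bool) (t m q : nat) : bool :=
  let a := (alphabet_size t %/ m.+2 ^ 2)%N in (b * a <= q < b * a + a)%N.

Definition survives (b : bool) (t L : nat) (w : edge_states t L) : pred nat :=
  fun j => [forall e : 'I_(L + t) * 'I_t,
    ~~ ((e.1 == j + t :> nat)%N && kills_left t e.2 (w e)) &&
    ~~ ((e.1 + e.2.+1 == j + t)%N && kills_right b t e.2 (w e))].

Lemma alphabet_sizeE (t m : nat) : (m < t)%N ->
  (alphabet_size t %/ m.+2 ^ 2 * m.+2 ^ 2)%N = alphabet_size t.
Proof.
by move=> mt; rewrite divnK// dvdn_exp2r// dvdn_fact//= ltnS mt.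
Qed.

(** In each case the forbidden outcomes fill one interval, of length [0], [a] or [b.+1 * a]. When
    both ends matter, [pair_ratio] corrects the independent value [(1 - beta)^2]. *)
Lemma card_edge_ok (R : realFieldType) (b l r : bool) (t m : nat) : (m < t)%N ->
  #|[pred q : 'I_(alphabet_size t) |
     ~~ (l && kills_left t m q) && ~~ (r && kills_right b t m q)]|%:R
  = (alphabet_size t)%:R *
    ((if l then 1 - kill_prob R m else 1) *
     (if r then 1 - kill_prob R m else 1) *
     (if l && r then pair_ratio R b m else 1)).
Proof.
move=> mt; have := alphabet_sizeE mt; rewrite /kills_left /kills_right.
set Q := alphabet_size t; set a := (Q %/ _)%N => aQ.
have ltQ len : (len <= 4)%N -> (len * a <= Q)%N.
  by move=> l4; rewrite -aQ mulnC leq_mul2l -mulnn (leq_trans l4) ?orbT//; nia.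
have b1 : 1 - kill_prob R m != 0.
  have /andP[_ b4] := kill_prob_bounds R m.
  by apply: lt0r_neq0; lra.
have aR : a%:R = Q%:R * kill_prob R m.
  by rewrite -aQ natrM mulfK// pnatr_eq0.
have card_out (p : pred 'I_Q) lo len : (lo + len <= Q)%N ->
    p =1 (fun q => ~~ (lo <= q < lo + len)%N) -> #|p|%:R = Q%:R - len%:R :> R.
  move=> le pE; rewrite -natrB ?(leq_trans _ le)// ?leq_addl//.
  by rewrite -(card_ord_outside le); congr _%:R; apply: eq_card => q; exact: pE.
case: l; case: r => /=.
- rewrite (card_out _ 0%N (b.+1 * a)%N) ?add0n ?ltQ//; last 2 first.
  + by case: (b).
  + by move=> q; case: (b) => /=; rewrite -negb_or; congr negb; lia.
  by rewrite natrM aR /pair_ratio; field.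
- rewrite (card_out _ 0%N a); first by rewrite aR; ring.
    by rewrite add0n -[a]mul1n ltQ.
  by move=> q /=; rewrite andbT.
- rewrite (card_out _ (b * a)%N a)//.
    by rewrite aR; ring.
  by rewrite -{2}[a]mul1n -mulnDl ltQ//; case: (b).
- by rewrite (eq_card (_ : _ =i predT))// card_ord; ring.
Qed.

Definition survival_prob (R : realFieldType) (b : bool) (t : nat) (S : seq nat) : R :=
  (\prod_(m < t) (1 - kill_prob R m)) ^+ 2 ^+ size S *
  \prod_(x <- S) \prod_(y <- S) pair_factor R b x y.

(** Survival of a translate is a separate condition on the state of each edge, so the good outcomes
    form a [family], whose cardinality is a product over edges. *)
Lemma card_survivors (R : realFieldType) (b : bool) (t L j : nat) (S : seq nat) :
  uniq S -> (forall s, s \in S -> (s <= t)%N) ->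
  (forall s, s \in S -> (j + s < L)%N) ->
  #|[pred w : edge_states t L | translates_in (survives b w) S j]|%:R
    = survival_prob R b t S * #|edge_states t L|%:R.
Proof.
move=> uS St SL; set V := [seq (j + s + t)%N | s <- S].
pose ok (e : 'I_(L + t) * 'I_t) := [pred q : 'I_(alphabet_size t) |
  ~~ (((e.1 : nat) \in V) && kills_left t e.2 q) &&
  ~~ (((e.1 + e.2.+1)%N \in V) && kills_right b t e.2 q)].
have -> : #|[pred w : edge_states t L | translates_in (survives b w) S j]|
    = #|(family ok : simpl_pred {ffun 'I_(L + t) * 'I_t -> 'I_(alphabet_size t)})|.
  apply: eq_card => w; rewrite !inE; apply/allP/familyP => [H e|H s sS].
    rewrite inE; apply/andP; split; apply/andP => -[/mapP[s sS es] k].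
      by have /forallP/(_ e) := H s sS; rewrite es eqxx k.
    by have /forallP/(_ e) := H s sS; rewrite es eqxx k andbF.
  apply/forallP => e; have := H e; rewrite inE => /andP[H1 H2].
  apply/andP; split.
    apply: contra H1 => /andP[/eqP -> ->]; rewrite andbT; exact: map_f.
  apply: contra H2 => /andP[/eqP -> ->]; rewrite andbT; exact: map_f.
rewrite card_family foldrE big_map big_enum /= natr_prod.
rewrite (eq_bigr _ (fun e _ => card_edge_ok R b _ _ (ltn_ord e.2))).
rewrite big_split/= mulrC prod_edges.
- congr (_ * _); last by rewrite card_ffun prodr_const card_ord natrX.
  rewrite /survival_prob size_map; congr (_ * _).
  rewrite big_map; apply: eq_bigr => x _; rewrite big_map.
  apply: eq_bigr => y _; rewrite /pair_factor.
  by rewrite ltn_add2r ltn_add2l subnDr subnDl.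
- by rewrite map_inj_in_uniq// => x y _ _; lia.
- by move=> _ /mapP[s sS ->]; have := SL s sS; lia.
- by move=> _ _ /mapP[s sS ->] /mapP[u uSS ->]; have := St u uSS; lia.
Qed.

(** * Periodic stages and their discrepancy *)

Lemma survival_prob_bounds (R : realFieldType) (b : bool) (t : nat) (S : seq nat) :
  uniq S -> (forall s, s \in S -> (s <= t)%N) ->
  0 <= survival_prob R b t S <= 1.
Proof.
move=> uS St.
(* With word length [t.+1] and [j = 0] the probability is a ratio of cardinalities. *)
have := @card_survivors R b t t.+1 0 S uS St St.
have W0 : (0 < #|edge_states t t.+1|%:R :> R).
  by rewrite ltr0n card_ffun card_ord expn_gt0 expn_gt0 fact_gt0.
move=> H; apply/andP; split.
  by rewrite -(pmulr_lge0 _ W0) -H.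
by rewrite -(ler_pM2r W0) -H mul1r ler_nat max_card.
Qed.

Definition stage (b : bool) (t : nat) : pred nat :=
  cyclic_words (@survives b t t.+1) t.+1.

Definition stage_period (t : nat) : nat := (#|edge_states t t.+1| * t.+1)%N.

Lemma stage_discrepancy (R : realFieldType) (b : bool) (t K : nat) (S : seq nat) :
  uniq S -> (forall s, s \in S -> (s <= K)%N) -> (K <= t)%N ->
  forall N,
    `|\sum_(0 <= k < N)
        ((translates_in (stage b t) S k)%:R - survival_prob R b t S)|
      <= K%:R / t.+1%:R * N%:R + (stage_period t)%:R.
Proof.
move=> uS SK Kt N.
have St s : s \in S -> (s <= t)%N by move/SK/leq_trans; exact.
apply: cyclic_words_discrepancy => //.
- by rewrite card_ffun card_ord expn_gt0 expn_gt0 fact_gt0.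
- exact: survival_prob_bounds.
- by move=> j jK; apply: card_survivors => // s /SK; lia.
Qed.

(** * Splicing the stages along fast growing intervals *)

Lemma between_increasing (a : nat -> nat) (n : nat) :
  (forall t, (a t < a t.+1)%N) -> (a 0 <= n)%N ->
  exists t, (a t <= n < a t.+1)%N.
Proof.
move=> a_lt; elim: n => [|n IH] an.
  by exists 0%N; rewrite an; have := a_lt 0%N; lia.
have [an'|an'] := leqP (a 0%N) n; last first.
  by exists 0%N; have := a_lt 0%N; lia.
have [t tn] := IH an'; have [nt|tn'] := ltnP n.+1 (a t.+1).
  by exists t; lia.
by exists t.+1; have := a_lt t.+1; lia.
Qed.

(* Each new interval starts beyond (t + 1) times everything that must become
   negligible: the earlier intervals and the two periods in play. *)
Fixpoint splice_point (P : nat -> nat) (t : nat) : nat :=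
  if t is t'.+1 then (t * (splice_point P t' + P t' + P t + 1))%N else 1.

Lemma splice_point_lt (P : nat -> nat) (t : nat) :
  (splice_point P t < splice_point P t.+1)%N.
Proof. rewrite /= mulSn; lia. Qed.

Lemma splice_point_le (P : nat -> nat) (s t : nat) :
  (s <= t)%N -> (splice_point P s <= splice_point P t)%N.
Proof.
elim: t => [|t IH]; first by rewrite leqn0 => /eqP ->.
rewrite leq_eqVlt => /predU1P[-> //|/IH st].
by have := splice_point_lt P t; lia.
Qed.

Definition splice (X : nat -> pred nat) (P : nat -> nat) : pred nat :=
  fun k => `[< exists2 t, (splice_point P t <= k < splice_point P t.+1)%N & X t k >].

Lemma spliceE (X : nat -> pred nat) (P : nat -> nat) (t k : nat) :
  (splice_point P t <= k < splice_point P t.+1)%N -> splice X P k = X t k.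
Proof.
move=> tk; apply/asboolP/idP => [[s sk]|]; last by exists t.
have [st|ts|->//] := ltngtP s t.
  by have := splice_point_le P st; lia.
by have := splice_point_le P ts; lia.
Qed.

Lemma splice0 (X : nat -> pred nat) (P : nat -> nat) : splice X P 0 = false.
Proof.
apply/asboolP => -[t]; have := splice_point_le P (leq0n t).
by rewrite [splice_point P 0]/=; lia.
Qed.

(** A translate starting in the window reads only the [t]-th set unless it starts among the last [K]
    positions. The window sum of that set is a difference of two initial sums, which doubles the
    error. *)
Lemma splice_window (R : realFieldType) (X : nat -> pred nat) (P : nat -> nat)
    (S : seq nat) (K t v : nat) (D e : R) :
  (forall s, s \in S -> (s <= K)%N) ->
  (forall N, `|\sum_(0 <= k < N) ((translates_in (X t) S k)%:R - D)|
               <= e * N%:R + (P t)%:R) ->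
  (splice_point P t <= v <= splice_point P t.+1)%N -> 0 <= e ->
  `|\sum_(splice_point P t <= k < v) ((translates_in (splice X P) S k)%:R - D)|
     <= K%:R + (e * v%:R + (P t)%:R) *+ 2.
Proof.
set u := splice_point P t => SK XP /andP[uv v1] e0.
pose f k := (translates_in (splice X P) S k)%:R - D.
pose g k := (translates_in (X t) S k)%:R - D.
have -> : \sum_(u <= k < v) f k
  = \sum_(u <= k < v) (f k - g k)
    + (\sum_(0 <= k < v) g k - \sum_(0 <= k < u) g k).
  rewrite (@big_cat_nat _ _ _ u 0 v)//= [_ + \sum_(_ <= _ < _) g _]addrC addrK.
  by rewrite -big_split/=; apply: eq_bigr => k _; rewrite subrK.
apply: le_trans (ler_normD _ _) _; apply: lerD; last first.
  apply: le_trans (ler_normB _ _) _; rewrite mulr2n; apply: lerD; first exact: XP.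
  by apply: le_trans (XP u) _; rewrite lerD2r ler_wpM2l// ler_nat.
pose w := maxn u (v - K).
have uw : (u <= w)%N by rewrite leq_maxl.
have wv : (w <= v)%N by rewrite geq_max uv leq_subr.
rewrite (@big_cat_nat _ _ _ w)//= big_nat big1 ?add0r; last first.
  move=> k kw; rewrite /f /g; apply/eqP; rewrite subr_eq0; apply/eqP.
  congr (_%:R - _); congr nat_of_bool; apply: eq_in_all => s /SK sK.
  by apply: spliceE; rewrite -/u; move: kw v1; rewrite /w; lia.
apply: le_trans (@norm_sum_nat_le _ _ 1 _ _ wv _) _.
  move=> k _; rewrite /f /g.
  by do 2![case: translates_in]; rewrite ler_norml/=; lra.
by rewrite mul1r ler_nat /w; lia.
Qed.

(** For [n] between the splice points [t + 1] and [t + 2], the stretch before point [t] is bounded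
    trivially and the two windows after it by the discrepancies of stages [t] and [t + 1]. The
    growth of [splice_point] bounds that stretch and both periods by [n / (t + 1)]. *)
Lemma cvg_splice (R : realType) (X : nat -> pred nat) (P : nat -> nat)
    (S : seq nat) (K : nat) (D : R) (e : nat -> R) :
  (forall s, s \in S -> (s <= K)%N) ->
  (forall t, 0 <= e t) -> e t @[t --> \oo] --> 0 ->
  (\forall t \near \oo, forall N,
     `|\sum_(0 <= k < N) ((translates_in (X t) S k)%:R - D)|
        <= e t * N%:R + (P t)%:R) ->
  (\sum_(1 <= k < N.+1) (translates_in (splice X P) S k)%:R) / N%:R @[N --> \oo]
    --> D.
Proof.
move=> SK e0 e_cvg XP.
pose a := splice_point P.
(* Here [1 + |D|] bounds each term of the initial stretch, [K *+ 2] the two window ends, and the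
   remaining 4 covers the doubled periods. *)
pose C : R := 5 + `|D| + K%:R *+ 2.
pose eta t := C * t.+1%:R^-1 + (e t + e t.+1) *+ 2.
have eta_cvg : eta t @[t --> \oo] --> 0.
  rewrite (_ : 0 = C * 0 + (0 + 0) *+ 2 :> R); last by ring.
  apply: cvgD; first by apply: cvgMr; exact: cvg_harmonic.
  by apply: cvgMn; apply: cvgD => //; rewrite -cvg_shiftS in e_cvg.
have bound t n : (forall N,
     `|\sum_(0 <= k < N) ((translates_in (X t) S k)%:R - D)|
        <= e t * N%:R + (P t)%:R) -> (forall N,
     `|\sum_(0 <= k < N) ((translates_in (X t.+1) S k)%:R - D)|
        <= e t.+1 * N%:R + (P t.+1)%:R) ->
    (a t.+1 <= n <= a t.+2)%N ->
    `|\sum_(1 <= k < n) ((translates_in (splice X P) S k)%:R - D)| <= eta t * n%:R.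
  move=> Xt Xt1 /andP[tn nt].
  have a1 : (1 <= a t)%N by exact: (splice_point_le P (leq0n t)).
  have att : (a t <= a t.+1)%N by exact/ltnW/splice_point_lt.
  rewrite (@big_cat_nat _ _ _ (a t)) ?(leq_trans att)//=.
  rewrite (@big_cat_nat _ _ _ (a t.+1) (a t))//=.
  apply: le_trans (ler_normD _ _) _.
  have t1n : (a t.+1)%:R <= n%:R :> R by rewrite ler_nat.
  have B1 : `|\sum_(1 <= k < a t) ((translates_in (splice X P) S k)%:R - D)|
      <= (1 + `|D|) * (a t)%:R.
    apply: le_trans (@norm_sum_nat_le _ _ (1 + `|D|) _ _ a1 _) _.
      move=> k _; apply: le_trans (ler_normB _ _) _; rewrite lerD2r.
      by case: translates_in; rewrite ?normr1 ?normr0.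
    by rewrite ler_wpM2l ?addr_ge0// ler_nat leq_subr.
  have B2 : `|\sum_(a t <= k < a t.+1)
      ((translates_in (splice X P) S k)%:R - D)|
      <= K%:R + (e t * (a t.+1)%:R + (P t)%:R) *+ 2.
    by apply: splice_window => //; rewrite att leqnn.
  have B3 : `|\sum_(a t.+1 <= k < n) ((translates_in (splice X P) S k)%:R - D)|
      <= K%:R + (e t.+1 * n%:R + (P t.+1)%:R) *+ 2.
    by apply: splice_window => //; rewrite tn nt.
  apply: le_trans (lerD B1 (le_trans (ler_normD _ _) (lerD B2 B3))) _.
  pose y : R := t.+1%:R^-1 * n%:R.
  have ay : (a t)%:R + (P t)%:R + (P t.+1)%:R + 1 <= y.
    rewrite -(ler_pM2l (x := t.+1%:R)) ?ltr0n// mulrA mulfV ?mul1r ?pnatr_eq0//.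
    by move: (tn); rewrite -(ler_nat R) natrM !natrD.
  have y1 : K%:R <= K%:R * y.
    rewrite -{1}[K%:R]mulr1 ler_wpM2l//; apply: le_trans ay.
    by rewrite lerDr !addr_ge0.
  have P0 : 0 <= (P t)%:R :> R by [].
  have P1 : 0 <= (P t.+1)%:R :> R by [].
  have a0 : 0 <= (a t)%:R :> R by [].
  have D1 : (1 + `|D|) * (a t)%:R <= (1 + `|D|) * y.
    by rewrite ler_wpM2l ?addr_ge0//; lra.
  have et : e t * (a t.+1)%:R <= e t * n%:R by rewrite ler_wpM2l.
  have -> : eta t * n%:R = C * y + (e t * n%:R + e t.+1 * n%:R) *+ 2.
    by rewrite /eta /y; ring.
  have -> : C * y = 4 * y + (1 + `|D|) * y + (K%:R * y) *+ 2.
    by rewrite /C; ring.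
  lra.
apply/cvgrPdist_lt => /= d d0.
(* The final bound involves [N.+1 <= 2 * N], so [d / 3] keeps it strictly below [d * N]. *)
have [t0 _ Ht0] : \forall t \near \oo, eta t <= d / 3 /\ (forall N,
     `|\sum_(0 <= k < N) ((translates_in (X t) S k)%:R - D)|
        <= e t * N%:R + (P t)%:R).
  near=> t; split; last by near: t; exact: XP.
  have : `|eta t - 0| <= d / 3.
    by rewrite distrC; near: t; move/cvgrPdist_le : eta_cvg; apply; rewrite divr_gt0.
  by rewrite subr0; apply: le_trans; exact: ler_norm.
(* Starting one interval later gives both stages in the estimate an index at least [t0]. *)
exists (a t0.+1) => // N/= tN.
have a0 : (0 < a t0.+1)%N by exact: (splice_point_le P (leq0n t0.+1)).
have [||t /andP[tn nt]] := @between_increasing a N.+1.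
- exact: splice_point_lt.
- by have := splice_point_le P (leq0n t0.+1); rewrite -/a; lia.
have t0t : (t0 < t)%N.
  rewrite ltnNge; apply/negP => tt0.
  have := splice_point_le P (tt0 : (t.+1 <= t0.+1)%N); rewrite -/a; lia.
case: t => [//|t] in tn nt t0t *.
have [e1 X1] := Ht0 t t0t.
have [_ X2] := Ht0 t.+1 (ltnW t0t).
have := bound t N.+1 X1 X2; rewrite tn ltnW// => /(_ isT).
have N0 : 0 < N%:R :> R by rewrite ltr0n; lia.
rewrite sumrB sumr_const_nat subn1/= => B.
rewrite distrC -[X in _ - X](mulfK (lt0r_neq0 N0)) -mulrBl normrM.
rewrite [`|N%:R^-1|]ger0_norm ?invr_ge0 ?ltW// ltr_pdivrMr// mulr_natr.
apply: le_lt_trans B _.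
have : eta t * N.+1%:R <= d / 3 * N.+1%:R by rewrite ler_wpM2r.
move/le_lt_trans; apply.
have N1 : 1 <= N%:R :> R by rewrite ler1n; lia.
have dN : d <= d * N%:R by rewrite ler_peMr// ltW.
by rewrite -[N.+1%:R]natr1 -mulr_natr mulrDr mulr1; lra.
Unshelve. all: by end_near.
Qed.

(** * Limiting densities of the survivor sets *)

Lemma kill_prob_prod (R : realFieldType) (t : nat) :
  \prod_(m < t) (1 - kill_prob R m) = (1 + t.+1%:R^-1) / 2.
Proof.
(* The factors [(m + 1)(m + 3) / (m + 2)^2] telescope; the limit [1 / 2], squared, is the density
   [1 / 4]. *)
elim: t => [|t IH]; first by rewrite big_ord0; field.
rewrite big_ord_recr/= IH /kill_prob natrX -[t.+2%:R]natr1 -[t.+1%:R]natr1.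
have t0 : 0 <= t%:R :> R by [].
by field; rewrite !lt0r_neq0//; lra.
Qed.

Definition pair_correlation (R : realFieldType) (b : bool) (S : seq nat) : R :=
  \prod_(x <- S) \prod_(y <- S) pair_factor R b x y.

Lemma survival_prob_cvg (R : realType) (b : bool) (S : seq nat) :
  survival_prob R b t S @[t --> \oo]
    --> 4%:R^-1 ^+ size S * pair_correlation R b S.
Proof.
have -> : (fun t => survival_prob R b t S) = (fun t =>
    ((1 + t.+1%:R^-1) / 2) ^+ (2 * size S) * pair_correlation R b S).
  by apply/funext => t; rewrite /survival_prob kill_prob_prod -exprM.
have -> : 4%:R^-1 ^+ size S = ((1 + 0) / 2) ^+ (2 * size S) :> R.
  by rewrite exprM; congr (_ ^+ _); field.
apply: cvgM; last exact: cvg_cst.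
apply: (@cvg_comp _ R R (fun t => (1 + t.+1%:R^-1) / 2)
  (fun x => x ^+ (2 * size S))); last exact: exprn_continuous.
apply: cvgM; last exact: cvg_cst.
by apply: cvgD; [exact: cvg_cst|exact: cvg_harmonic].
Qed.

Definition survivor_set (b : bool) : set nat :=
  [set k | splice (stage b) stage_period k].

Lemma survivor_correlation_cvg (R : realType) (b : bool) (S : seq nat) :
  uniq S ->
  (\sum_(1 <= k < N.+1)
     (translates_in (splice (stage b) stage_period) S k)%:R) / N%:R @[N --> \oo]
    --> 4%:R^-1 ^+ size S * pair_correlation R b S.
Proof.
move=> uS; set D := _ * _; pose K := \max_(s <- S) s.
have SK s : s \in S -> (s <= K)%N by move=> sS; exact: leq_bigmax_seq.
(* The first term is the loss at block boundaries, the second the effect of edges longer than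
   [t]. *)
pose e t : R := K%:R * t.+1%:R^-1 + `|survival_prob R b t S - D|.
apply: (@cvg_splice R _ _ S K D e SK).
- by move=> t; rewrite addr_ge0// mulr_ge0.
- rewrite (_ : 0 = K%:R * 0 + `|D - D| :> R); last first.
    by rewrite subrr normr0; ring.
  apply: cvgD; first by apply: cvgMl_tmp; exact: cvg_harmonic.
  by apply: cvg_norm; apply: cvgB; [exact: survival_prob_cvg|exact: cvg_cst].
- exists K => // t Kt N; have := stage_discrepancy R b uS SK Kt N.
  set F := survival_prob R b t S => FN.
  under eq_bigr do rewrite -[_ - D](subrKA F).
  rewrite big_split/= sumr_const_nat subn0.
  apply: le_trans (ler_normD _ _) _.
  by rewrite normrMn /e mulrDl addrAC lerD// mulr_natr.
Qed.

(** One computation serves [E], with [S = [:: 0]], and its return sets, with [S = 0 :: n]. *)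
Lemma density_survivors (R : realType) (b : bool) (S : seq nat) (A : set nat) :
  uniq S ->
  (forall k, A k <-> translates_in (splice (stage b) stage_period) S k) ->
  has_density R A /\
  density R A = 4%:R^-1 ^+ size S * pair_correlation R b S.
Proof.
move=> uS AE.
have cvgA : density_ratio R A @ \oo --> 4%:R^-1 ^+ size S * pair_correlation R b S.
  rewrite (_ : density_ratio R A = fun N => (\sum_(1 <= k < N.+1)
     (translates_in (splice (stage b) stage_period) S k)%:R) / N%:R).
    exact: survivor_correlation_cvg.
  apply/funext => N; rewrite /density_ratio -sum1_count natr_sum big_mkcond/=.
  congr (_ / _); apply: eq_bigr => k _.
  have -> : (k \in A) = translates_in (splice (stage b) stage_period) S k.
    by apply/idP/idP; rewrite inE => /AE.
  by case: translates_in.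
by split; [exact: cvgP cvgA|exact: cvg_lim cvgA].
Qed.

Lemma density_survivor_set (R : realType) (b : bool) :
  has_density R (survivor_set b) /\ density R (survivor_set b) = 4%:R^-1.
Proof.
have [||dE ->] := @density_survivors R b [:: 0%N] (survivor_set b) => //.
  by move=> k; rewrite /translates_in/= addn0 andbT.
split=> //; rewrite /pair_correlation !big_cons !big_nil /pair_factor ltnn.
by rewrite !mulr1.
Qed.

Lemma density_multi_return (R : realType) (b : bool) (l : nat) (n : l.-tuple nat) :
  uniq (0%N :: n) ->
  has_density R (multi_return (survivor_set b) n) /\
  density R (multi_return (survivor_set b) n)
    = 4%:R^-1 ^+ l.+1 * pair_correlation R b (0%N :: n).
Proof.
move=> un; have [|dE ->] := @density_survivors R b (0%N :: n)
    (multi_return (survivor_set b) n) un; last by rewrite /= size_tuple.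
move=> k; rewrite /multi_return /translates_in/= addn0; split.
  by move=> [-> kn]; apply/allP => m mn; exact: (kn m mn).
by move=> /andP[k0 /allP kn]; split => // m mn; exact: kn.
Qed.

(** * Strict inequalities for the pair correlation *)

Lemma prod_lt1 (R : realFieldType) (I : eqType) (s : seq I) (F : I -> R) (i : I) :
  (forall x, x \in s -> 0 < F x <= 1) -> i \in s -> F i < 1 ->
  \prod_(x <- s) F x < 1.
Proof.
move=> F01 /[dup] /F01 /andP[Fi0 _] is_ Fi1.
rewrite (big_rem i)//=; apply: le_lt_trans Fi1.
rewrite ler_piMr ?(ltW Fi0)// big_seq prodr_ile1// => x /mem_rem /F01 /andP[x0 ->].
by rewrite ltW.
Qed.

Lemma prod_gt0_le1 (R : realFieldType) (I : eqType) (s : seq I) (F : I -> R) :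
  (forall x, x \in s -> 0 < F x <= 1) -> 0 < \prod_(x <- s) F x <= 1.
Proof.
move=> F01; rewrite big_seq; apply/andP; split.
  by apply: prodr_gt0 => x /F01 /andP[].
by apply: prodr_ile1 => x /F01 /andP[x0 ->]; rewrite ltW.
Qed.

Lemma double_prod_lt1 (R : realFieldType) (S : seq nat) (F : nat -> nat -> R)
    (i j : nat) :
  (forall x y, 0 < F x y <= 1) -> i \in S -> j \in S -> F i j < 1 ->
  \prod_(x <- S) \prod_(y <- S) F x y < 1.
Proof.
move=> F01 iS jS Fij; apply: (prod_lt1 (i := i)) => //.
  by move=> x _; apply: prod_gt0_le1.
exact: (prod_lt1 (i := j)).
Qed.

(** The square [(1 - beta)^2] exceeds [1 - 2 beta] by [beta^2]; positivity comes from
    [beta <= 1/4]. *)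
Lemma pair_ratio_lt1 (R : realFieldType) (m : nat) :
  0 < pair_ratio R true m < 1.
Proof.
have /andP[k0 k4] := kill_prob_bounds R m; rewrite /pair_ratio.
have k1 : 0 < (1 - kill_prob R m) ^+ 2 by apply: exprn_gt0; lra.
rewrite divr_gt0//=; last by lra.
by rewrite ltr_pdivrMr// mul1r; nra.
Qed.

Lemma pair_ratio_gt1 (R : realFieldType) (m : nat) : 1 < pair_ratio R false m.
Proof.
have /andP[k0 k4] := kill_prob_bounds R m; rewrite /pair_ratio mul1r.
have k1 : 0 < (1 - kill_prob R m) ^+ 2 by apply: exprn_gt0; lra.
by rewrite ltr_pdivlMr// mul1r; nra.
Qed.

Lemma pair_correlation_lt1 (R : realFieldType) (S : seq nat) (i j : nat) :
  i \in S -> j \in S -> (i < j)%N -> pair_correlation R true S < 1.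
Proof.
move=> iS jS ij; apply: (double_prod_lt1 (i := i) (j := j)) => //.
  move=> x y; rewrite /pair_factor; case: ifP => _; rewrite ?ltr01 ?lexx//.
  by have /andP[-> /ltW] := pair_ratio_lt1 R (y - x).-1.
by rewrite /pair_factor ij; have /andP[] := pair_ratio_lt1 R (j - i).-1.
Qed.

Lemma pair_correlation_gt1 (R : realFieldType) (S : seq nat) (i j : nat) :
  i \in S -> j \in S -> (i < j)%N -> 1 < pair_correlation R false S.
Proof.
have F1 x y : 1 <= pair_factor R false x y.
  by rewrite /pair_factor; case: ifP => // _; exact/ltW/pair_ratio_gt1.
have F0 x y : 0 < pair_factor R false x y by exact: lt_le_trans (F1 x y).
(* Inverting every factor reduces the claim to a product of factors at most 1. *)
move=> iS jS ij; rewrite -[pair_correlation _ _ _]invrK invf_gt1; last first.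
  by rewrite invr_gt0 !prodr_gt0// => x _; exact: prodr_gt0.
rewrite /pair_correlation -prodfV.
under eq_bigr do rewrite -prodfV.
apply: (double_prod_lt1 (i := i) (j := j)) => //.
  by move=> x y; rewrite invr_gt0 F0 invf_le1 ?F1 ?F0.
by rewrite invf_lt1// /pair_factor ij pair_ratio_gt1.
Qed.

(** * Asymptotic independence as the gaps grow *)

Lemma kill_prob_cvg0 (R : realType) : kill_prob R m @[m --> \oo] --> 0.
Proof.
apply: (@squeeze_cvgr _ _ _ _ (fun=> 0) (@harmonic R)).
- apply: nearW => m; have /andP[/ltW -> _] /= := kill_prob_bounds R m.
  rewrite /kill_prob lef_pV2 ?posrE ?ltr0n ?expn_gt0// ler_nat -mulnn; lia.
- exact: cvg_cst.
- exact: cvg_harmonic.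
Qed.

Lemma pair_ratio_cvg1 (R : realType) (b : bool) :
  pair_ratio R b m @[m --> \oo] --> (1 : R).
Proof.
rewrite [X in _ --> X](_ : 1 = (1 - b.+1%:R * 0) / (1 - 0) ^+ 2 :> R); last first.
  by rewrite mulr0 subr0 expr1n divr1.
have k0 := @kill_prob_cvg0 R.
apply: cvgM; first by apply: cvgB; [exact: cvg_cst|exact: cvgMl_tmp].
apply: cvgV; first by rewrite subr0 expr1n oner_eq0.
apply: (@cvg_comp _ R R (fun m => 1 - kill_prob R m) (fun x => x ^+ 2));
  last exact: exprn_continuous.
by apply: cvgB => //; exact: cvg_cst.
Qed.

Lemma gaps_ge_nth (M l : nat) (n : l.-tuple nat) (i j : nat) :
  gaps_ge M n -> (i < j <= l)%N ->
  (nth 0 (0 :: n) i + M <= nth 0 (0 :: n) j)%N.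
Proof.
move=> nM /andP[ij jl].
have tr : transitive (fun a b => (a + M <= b)%N) by move=> y x z; lia.
apply: (sorted_ltn_nth tr 0%N (s := 0%N :: n)) => //;
  rewrite inE /= size_tuple; lia.
Qed.

Lemma pair_correlation_cvg1 (R : realType) (b : bool) (l : nat) :
  pair_correlation R b (0%N :: tval n) @[n --> gaps_to_infty l] --> (1 : R).
Proof.
pose p i (n : l.-tuple nat) := nth 0%N (0%N :: n) i.
have pE (n : l.-tuple nat) : pair_correlation R b (0%N :: n)
    = \prod_(i < l.+1) \prod_(j < l.+1) pair_factor R b (p i n) (p j n).
  rewrite /pair_correlation (big_nth 0%N) big_mkord /= size_tuple.
  apply: eq_bigr => i _; rewrite (big_nth 0%N) big_mkord /= size_tuple.
  by [].
rewrite (funext pE).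
rewrite [X in _ --> X](_ : 1 = \prod_(i < l.+1) \prod_(j < l.+1) (1 : R)); last first.
  by rewrite big1// => i _; rewrite big1.
apply: cvg_big => [|i _]; first exact: mul_continuous.
apply: cvg_big => [|j _]; first exact: mul_continuous.
have [ij|ji] := ltnP i j; last first.
  (* Already [gaps_ge 0] makes the entries nondecreasing, so this factor is 1. *)
  apply: cvg_near_cst; exists 0%N => // n /= nM.
  rewrite /pair_factor ltnNge (_ : (p j n <= p i n)%N)//.
  move: ji; rewrite leq_eqVlt => /predU1P[->//|ji].
  have := @gaps_ge_nth 0 l n j i nM; rewrite ji -ltnS ltn_ord => /(_ isT).
  by rewrite addn0.
apply: (@cvg_trans _
    (pair_ratio R b (p j n - p i n).-1 @[n --> gaps_to_infty l])).
  apply: near_eq_cvg; exists 1%N => // n /= nM.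
  have := @gaps_ge_nth 1 l n i j nM; rewrite ij -ltnS ltn_ord => /(_ isT).
  by rewrite /pair_factor addn1 => ->.
apply: (cvg_comp (fun n : l.-tuple nat => (p j n - p i n).-1) (pair_ratio R b));
  last exact: pair_ratio_cvg1.
move=> A [N _ NA]; exists N.+1 => // n /= nM; apply: NA => /=.
have := @gaps_ge_nth N.+1 l n i j nM; rewrite ij -ltnS ltn_ord => /(_ isT).
by rewrite /p; lia.
Qed.

Lemma gaps_ge1_uniq (l : nat) (n : l.-tuple nat) : gaps_ge 1 n -> uniq (0%N :: n).
Proof.
move=> n1; apply: (sorted_uniq ltn_trans ltnn); rewrite /=.
by apply: sub_path n1 => x y; rewrite addn1.
Qed.

Lemma multi_return_cvg (R : realType) (b : bool) (l : nat) :
  density R (multi_return (survivor_set b) n) @[n --> gaps_to_infty l]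
    --> density R (survivor_set b) ^+ l.+1.
Proof.
have [_ ->] := density_survivor_set R b.
apply: (@cvg_trans _ ((fun n : l.-tuple nat =>
    4%:R^-1 ^+ l.+1 * pair_correlation R b (0%N :: n)) @ gaps_to_infty l)).
  (* Gaps at least 1 make [0 :: n] free of repetitions, as the density formula requires. *)
  apply: near_eq_cvg; exists 1%N => // n /= n1.
  by have [_ ->] := density_multi_return R b (gaps_ge1_uniq n1).
have := cvgMl_tmp (a := 4%:R^-1 ^+ l.+1) (@pair_correlation_cvg1 R b l).
by rewrite mulr1; exact.
Qed.

Lemma survivor_set_gt0 (b : bool) : survivor_set b `<=` [set k : nat | (0 < k)%N].
Proof. by move=> [|k]//=; rewrite /survivor_set/= splice0. Qed.

Theorem theorem2p9 (R : realType) (r : nat) (r_gt0 : (0 < r)%N) :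
  (exists E : set nat,
    [/\ E `<=` [set k : nat | (0 < k)%N],
        has_density R E &
        forall l : nat, (1 <= l <= r)%N ->
          (forall n : l.-tuple nat,
             (forall m : nat, m \in n -> (0 < m)%N) -> uniq n ->
             has_density R (multi_return E n) /\
             density R (multi_return E n) < density R E ^+ l.+1) /\
          density R (multi_return E n) @[n --> gaps_to_infty l]
            --> density R E ^+ l.+1]) /\
  (exists E : set nat,
    [/\ E `<=` [set k : nat | (0 < k)%N],
        has_density R E &
        forall l : nat, (1 <= l <= r)%N ->
          (forall n : l.-tuple nat,
             (forall m : nat, m \in n -> (0 < m)%N) -> uniq n ->
             has_density R (multi_return E n) /\
             density R (multi_return E n) > density R E ^+ l.+1) /\
          density R (multi_return E n) @[n --> gaps_to_infty l]
            --> density R E ^+ l.+1]).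
Proof.
have c0 l : 0 < 4%:R^-1 ^+ l.+1 :> R by rewrite exprn_gt0// invr_gt0.
(* The entry 0 stands for [E] itself; since [l > 0], some [m > 0] in [n] forms a pair with it, and
   one pair suffices for strictness. *)
have nP l (n : l.-tuple nat) : (0 < l)%N ->
    (forall m : nat, m \in n -> (0 < m)%N) -> uniq n ->
    uniq (0%N :: n) /\ exists2 m, m \in (0%N :: n) & (0 < m)%N.
  move=> l0 n0 un; split=> /=.
    by rewrite un andbT; apply/negP => /n0.
  exists (tnth n (Ordinal l0)); last exact/n0/mem_tnth.
  by rewrite in_cons mem_tnth orbT.
split.
  exists (survivor_set true); have [dE dEE] := density_survivor_set R true.
  split=> // [|l /andP[l0 _]]; first exact: survivor_set_gt0.
  split=> [n n0 un|]; last exact: multi_return_cvg.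
  have [u0 [m mn m0]] := nP l n l0 n0 un.
  have [dM ->] := density_multi_return R true u0; split=> //.
  rewrite dEE gtr_pMr//; apply: (pair_correlation_lt1 _ _ mn m0).
  exact: mem_head.
exists (survivor_set false); have [dE dEE] := density_survivor_set R false.
split=> // [|l /andP[l0 _]]; first exact: survivor_set_gt0.
split=> [n n0 un|]; last exact: multi_return_cvg.
have [u0 [m mn m0]] := nP l n l0 n0 un.
have [dM ->] := density_multi_return R false u0; split=> //.
rewrite dEE ltr_pMr//; apply: (pair_correlation_gt1 _ _ mn m0).
exact: mem_head.
Qed.
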